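(* Let $q(u)=\sqrt{u(1-u)\log\log(1/(u(1-u)))}$, $0<u<1$, let $\alpha\in(0,1)$, and let $t^+_\alpha(q)$ be the critical value satisfying $\mathbf{P}\left(\sup_{0<u<1}B(u)/q(u)\geq t^+_\alpha(q)\right)=\alpha$, where $\{B(u),0\leq u\leq 1\}$ is a Brownian bridge. For $S_1,\ldots,S_n$ independent identically distributed with values in $[0,1]$ and $\mathbb{H}_n(u)=n^{-1}\sum_{i=1}^n\mathbb{I}(S_i\leq u)$, let $$T_n^+(q)=\sup_{0<u<1}\frac{\sqrt{n}\,(\mathbb{H}_n(u)-u)}{q(u)},$$ and consider the test of asymptotic level $\alpha$ that rejects the null hypothesis $\mathcal{H}'_0$ (the $S_i$ are uniform on $(0,1)$) when $T_n^+(q)\geq t^+_\alpha(q)$. Let $\nu\geq 1$ be an integer, let $\beta\in(1/2,1)$ and $r\in(0,1)$ satisfy $r>\rho(\beta)$, where $$\rho(\beta)=\begin{cases}\beta-1/2, & 1/2<\beta<3/4,\\ (1-\sqrt{1-\beta})^2, & 3/4\leq\beta<1,\end{cases}$$ and put $\varepsilon_n=n^{-\beta}$, $\delta_n=2r\log n$. Let $\mathcal{H}'_{1,n}$ be the alternative under which $S_1,\ldots,S_n$ are independent identically distributed with common cumulative distribution function $$\mathcal{H}(u)=u+\varepsilon_n\left((1-u)-H_{\nu,\delta_n}\left(H_{\nu,0}^{-1}(1-u)\right)\right),\qquad 0<u<1,$$ where $H_{\nu,\delta}$ is the cumulative distribution function of the noncentral chi-square distribution $\chi^2_\nu(\delta)$.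 Then the test has full power against $\mathcal{H}'_{1,n}$, that is, $$\mathbf{P}_{\mathcal{H}'_{1,n}}\left(T_n^+(q)\geq t^+_\alpha(q)\right)\to 1,\qquad n\to\infty.$$
   Context: $\chi^2_\nu(\delta)$ denotes the noncentral chi-square distribution with $\nu$ degrees of freedom and noncentrality parameter $\delta\geq 0$, i.e. the law of $\sum_{i=1}^{\nu}(Z_i+\theta_i)^2$ with $Z_1,\ldots,Z_\nu$ independent standard normal and $\sum_{i=1}^\nu\theta_i^2=\delta$. $\log$ is the natural logarithm, $\mathbb{I}(A)$ is the indicator of $A$. The observations arise as $S_i=1-H_{\nu,0}(X_i)$, where under $\mathcal{H}'_0$ the $X_1,\ldots,X_n$ are independent $\chi^2_\nu(0)$, and under $\mathcal{H}'_{1,n}$ they are independent with the mixture distribution $(1-\varepsilon_n)\chi^2_\nu(0)+\varepsilon_n\chi^2_\nu(\delta_n)$; $\mathbf{P}_{\mathcal{H}'_{1,n}}$ denotes probability under $\mathcal{H}'_{1,n}$. *)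

(* Defs.v *)
From HB Require Import structures.
From mathcomp Require Import all_boot all_order all_algebra.
From mathcomp Require Import all_classical all_reals all_analysis.

Set Implicit Arguments.
Unset Strict Implicit.
Unset Printing Implicit Defensive.

Import Order.TTheory GRing.Theory Num.Theory.
Import numFieldNormedType.Exports.

Local Open Scope classical_set_scope.
Local Open Scope ring_scope.

Definition mutually_independent {d : measure_display} {T : measurableType d}
    {R : realType} (P : probability T R) {I : finType}
    (X : I -> {RV P >-> R}) : Prop :=
  forall (J : {set I}) (A : I -> set R),
    (forall i, i \in J -> measurable (A i)) ->
    (P (\bigcap_(i in [set` J]) (X i @^-1` A i)) =
     \prod_(i in J) P (X i @^-1` A i))%E.

(* The normal distribution with mean m and variance v >= 0, a point mass when
   v = 0; the library's normal_prob takes the standard deviation, and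
   normal_prob m 0 is not degenerate. *)
Definition normal_law {R : realType} (m v : R) : set R -> \bar R :=
  fun A => if v == 0 then \d_m A else normal_prob m (Num.sqrt v) A.

(* Standard Brownian bridge on [0, 1]: a centered Gaussian process (all finite
   linear combinations are normal) with covariance min(s, t) - s t and
   continuous paths; the values B u for u outside [0, 1] are irrelevant. *)
Definition brownian_bridge {d : measure_display} {T : measurableType d}
    {R : realType} (P : probability T R) (B : R -> {RV P >-> R}) : Prop :=
  (forall (k : nat) (u a : 'I_k -> R), (forall i, 0 <= u i <= 1) ->
     forall A : set R, measurable A ->
     P [set w | A (\sum_(i < k) a i * B (u i) w)] =
     normal_law 0 (\sum_(i < k) \sum_(j < k)
       a i * a j * (Num.min (u i) (u j) - u i * u j)) A) /\
  (forall w : T, {within `[0, 1]%classic, continuous (fun u : R => B u w)}).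

(* mu is chi^2_nu(delta): the law of \sum_i (Z_i + theta_i)^2 for some
   independent standard normal Z_i and some theta with
   \sum_i theta_i^2 = delta. *)
Definition is_noncentral_chi2 {R : realType} (nu : nat) (delta : R)
    (mu : probability (measurableTypeR R) R) : Prop :=
  exists (d : measure_display) (T : measurableType d) (P : probability T R)
    (Z : 'I_nu -> {RV P >-> R}) (theta : 'I_nu -> R),
    [/\ mutually_independent Z,
        (forall i (A : set R), measurable A ->
           distribution P (Z i) A = normal_prob 0 1 A),
        \sum_(i < nu) theta i ^+ 2 = delta &
        forall A : set R, measurable A ->
          mu A = P [set w | A (\sum_(i < nu) (Z i w + theta i) ^+ 2)]].

Definition law_cdf {R : realType} (mu : probability (measurableTypeR R) R)
    (x : R) : R := fine (mu `]-oo, x]%classic).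

(* The inverse of a distribution function F on (0, 1), as a generalized
   inverse. *)
Definition quantile {R : realType} (F : R -> R) (p : R) : R :=
  inf [set x | p <= F x].

Definition q {R : realType} (u : R) : R :=
  Num.sqrt (u * (1 - u) * ln (ln (u * (1 - u))^-1)).

Definition sup_bridge {d : measure_display} {T : measurableType d}
    {R : realType} {P : probability T R} (B : R -> {RV P >-> R})
    (w : T) : \bar R :=
  ereal_sup [set (B u w / q u)%:E | u in `]0, 1[%classic].

Definition empirical_cdf {R : realType} {n : nat} (s : 'I_n -> R)
    (u : R) : R :=
  n%:R^-1 * \sum_(i < n) (s i <= u)%R%:R.

(* An extended real: the supremum is +oo if some s i = 0. *)
Definition Tplus {R : realType} {n : nat} (s : 'I_n -> R) : \bar R :=
  ereal_sup [set (Num.sqrt n%:R * (empirical_cdf s u - u) / q u)%:E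
            | u in `]0, 1[%classic].

Definition rho {R : realType} (beta : R) : R :=
  if beta < 3 / 4 then beta - 1 / 2 else (1 - Num.sqrt (1 - beta)) ^+ 2.

Definition eps {R : realType} (beta : R) (n : nat) : R := n%:R `^ (- beta).

Definition dlt {R : realType} (r : R) (n : nat) : R := 2 * r * ln n%:R.

(* The distribution function of S = 1 - H_{nu,0}(X) under the alternative,
   with F0 = H_{nu,0}, Fdelta = H_{nu,delta} and mixing proportion e. *)
Definition alt_cdf {R : realType} (e : R) (F0 Fdelta : R -> R) (u : R) : R :=
  u + e * ((1 - u) - Fdelta (quantile F0 (1 - u))).

(* Main.v *)
Require Import Defs.
From HB Require Import structures.
From mathcomp Require Import all_boot all_order all_algebra.
From mathcomp Require Import all_classical all_reals all_analysis.
From mathcomp Require Import measurable_realfun ring lra.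

Set Implicit Arguments.
Unset Strict Implicit.
Unset Printing Implicit Defensive.

Import Order.TTheory GRing.Theory Num.Theory.
Import numFieldNormedType.Exports.

Local Open Scope classical_set_scope.
Local Open Scope ring_scope.

(* Only one point of the empirical process is needed. Let L = log n, let u = e^(-s L)
   and let x be the (1 - u)-quantile of chi^2_nu(0), so x <= 2 s' L for any s' > s
   and n large. Under the alternative the cdf at u exceeds u by
   n^(-beta) (P(chi^2_nu(2 r L) > x) - u), and the noncentral tail is at least
   n^(-kappa) for any kappa > (sqrt s - sqrt r)^2. By Chebyshev's inequality the
   empirical process at u, divided by q(u), exceeds any constant with probability
   tending to 1 as soon as kappa < 1 - beta, kappa < s and
   2 beta + 2 kappa < s + 1. With s = 4 r when r < 1/4 and s = 1 otherwise, such a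
   kappa exists exactly because r > rho(beta). *)

(** * Normal tails *)

Section gaussian.
Context {R : realType}.
Implicit Types (m y h : R) (A : set R).

Lemma measurable_sqr_ge (h : R) : measurable [set z : R | h <= z ^+ 2].
Proof.
rewrite [X in measurable X](_ : _ = setT `&`
  (fun z : R => z ^+ 2) @^-1` `[h, +oo[%classic).
  by apply: measurable_funX.
by rewrite setTI; apply/seteqP; split => z /=; rewrite in_itv/= andbT.
Qed.

Lemma measurable_signed_gt (b : bool) (y : R) :
  measurable [set z : R | y < (-1) ^+ b * z].
Proof.
rewrite [X in measurable X](_ : _ = setT `&`
  (fun z : R => (-1) ^+ b * z) @^-1` `]y, +oo[%classic).
  by apply: measurable_funM.
by rewrite setTI; apply/seteqP; split => z /=; rewrite in_itv/= andbT.
Qed.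

Lemma normal_pdf01E m z :
  normal_pdf m 1 z = normal_peak 1 * expR (- ((z - m) ^+ 2 / 2)) :> R.
Proof.
by rewrite normal_pdfE ?oner_neq0// /normal_fun expr1n mulNr.
Qed.

Let measurable_pdf m A : measurable_fun A (fun x => (normal_pdf m 1 x)%:E).
Proof.
by apply/measurable_EFinP/measurable_funTS; exact: measurable_normal_pdf.
Qed.

(* On [A] the standard normal density is at most [expR (- m ^+ 2 / 2)] times the
   density centred at [m]. *)
Lemma normal_prob_shift m A : measurable A ->
  (forall z, A z -> m ^+ 2 <= m * z) ->
  (normal_prob 0 1 A <= (expR (- (m ^+ 2 / 2)))%:E)%E.
Proof.
move=> mA Am.
apply: (@le_trans _ _ ((expR (- (m ^+ 2 / 2)))%:E * normal_prob m 1 A))%E.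
  rewrite /normal_prob -ge0_integralZl//=.
  - apply: ge0_le_integral => //=.
    + by move=> x _; rewrite lee_fin normal_pdf_ge0.
    + exact: measurable_pdf.
    + exact: (measurable_funeM _ (@measurable_pdf m A)).
    move=> z Az; rewrite lee_fin !normal_pdf01E mulrCA -expRD.
    rewrite ler_wpM2l ?normal_peak_ge0// ler_expR.
    by have := Am _ Az; rewrite subr0 => ?; nra.
  - exact: measurable_pdf.
  - by move=> x _; rewrite lee_fin normal_pdf_ge0.
rewrite -[leRHS]mule1 lee_pmul2l ?lte_fin ?expR_gt0//.
exact: probability_le1.
Qed.

(** The event splits into two half-lines; each is compared with the density centred at its own
    endpoint, whence the factor 2. *)
Lemma normal_prob_sqr_ge h : 0 <= h ->
  (normal_prob 0 1 [set z : R | (h <= z ^+ 2)%R] <= (2 * expR (- (h / 2)))%:E)%E.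
Proof.
move=> h0; rewrite -(sqr_sqrtr h0).
move: (Num.sqrt h) (sqrtr_ge0 h) => y y0 {h h0}.
have -> : [set z : R | y ^+ 2 <= z ^+ 2] =
    [set` `[y, +oo[%R] `|` [set` `]-oo, - y]%R].
  apply/seteqP; split => z /=; rewrite !in_itv/= andbT.
    by move=> ?; have [?|?] := leP y z; [left|right; nra].
  by case=> ?; nra.
rewrite (le_trans (measureU2 _ _ _))//= mulr_natl mulr2n EFinD.
apply: leeD.
  by apply: normal_prob_shift => // z /=; rewrite in_itv/= andbT expr2; nra.
rewrite -sqrrN; apply: normal_prob_shift => // z /=; rewrite in_itv/= expr2.
by nra.
Qed.

Lemma normal_prob_ge m A : measurable A -> lebesgue_measure A = 1%E ->
  (forall z, A z -> `|z| <= m) ->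
  ((normal_peak 1 * expR (- (m ^+ 2 / 2)))%:E <= normal_prob 0 1 A)%E.
Proof.
move=> mA A1 Am.
rewrite -[leLHS]mule1 -A1 -integral_cst//; apply: ge0_le_integral => //=.
- by move=> z _; rewrite lee_fin mulr_ge0 ?normal_peak_ge0 ?expR_ge0.
- exact: measurable_pdf.
move=> z /Am zm; rewrite lee_fin normal_pdf01E subr0.
rewrite ler_wpM2l ?normal_peak_ge0// ler_expR lerN2 ler_wpM2r//.
by rewrite -[leLHS]real_normK ?num_real// lerXn2r ?nnegrE// (le_trans _ zm).
Qed.

Lemma normal_prob_halfline_ge (b : bool) y : 0 <= y ->
  ((normal_peak 1 * expR (- ((y + 1) ^+ 2 / 2)))%:E <=
   normal_prob 0 1 [set z : R | (y < (-1) ^+ b * z)%R])%E.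
Proof.
move=> y0.
(* Only the unit interval next to the endpoint is kept; the sign [(-1) ^+ b] treats both tails at
   once. *)
pose A : set R := if b then [set` `[- (y + 1), - y[%R] else [set` `]y, y + 1]%R].
have mA : measurable A by rewrite /A; case: b {A}.
apply: (@le_trans _ _ (normal_prob 0 1 A)).
  apply: normal_prob_ge => //.
    rewrite /A; case: b {A mA} => /=; rewrite lebesgue_measure_itv/= lte_fin.
      rewrite ifT; last by lra.
      by rewrite -EFinD; congr EFin; lra.
    rewrite ifT; last by lra.
    by rewrite -EFinD; congr EFin; lra.
  move=> z; rewrite /A ler_norml; case: b {A mA} => /=; rewrite in_itv/=; lra.
apply: le_measure; rewrite ?inE//; first exact: measurable_signed_gt.
move=> z; rewrite /A; case: b {A mA} => /=;
  rewrite in_itv/= ?expr1 ?expr0; lra.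
Qed.
End gaussian.

(** * Independence and union bounds for finite families *)

Lemma lee_prod (R : realType) (I : finType) (f g : I -> \bar R) :
  (forall i, 0 <= f i)%E -> (forall i, f i <= g i)%E ->
  (\prod_i f i <= \prod_i g i)%E.
Proof.
move=> f0 fg; have [] //: (0 <= \prod_i f i /\ \prod_i f i <= \prod_i g i)%E.
elim/big_ind2 : _ => // x1 x2 y1 y2 [x0 x12] [y0 y12].
by split; [exact: mule_ge0|exact: lee_pmul].
Qed.

Section finite_families.
Context d (T : measurableType d) (R : realType) (P : probability T R).

Lemma mutually_independent_all (I : finType) (X : I -> {RV P >-> R})
    (A : I -> set R) : mutually_independent X -> (forall i, measurable (A i)) ->
  P [set w | forall i, A i (X i w)] = (\prod_i distribution P (X i) (A i))%E.
Proof.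
move=> indX mA; have := indX finset.setT A (fun i _ => mA i).
rewrite (eq_bigl _ _ (fun i => finset.in_setT i)) => <-.
by congr (P _); apply/seteqP; split => w /= wA i; [move=> _|]; apply: wA;
  rewrite /= ?finset.in_setT.
Qed.

Lemma measurable_forall_preimage (I : finType) (X : I -> {RV P >-> R})
    (A : I -> set R) : (forall i, measurable (A i)) ->
  measurable [set w | forall i, A i (X i w)].
Proof.
move=> mA.
have -> : [set w | forall i, A i (X i w)] = \bigcap_(i in [set: I]) (X i @^-1` A i).
  by apply/seteqP; split => w /= wA i; [move=> _|]; apply: wA.
apply: fin_bigcap_measurable => // i _.
by rewrite -[X in measurable X]setTI; exact: measurable_funP.
Qed.

Lemma probability_finite_cover (I : finType) (Q : pred I) (E : I -> set T)
    (A : set T) (c : R) : 0 <= c -> measurable A ->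
  (forall i, measurable (E i)) ->
  (A `<=` [set w | exists2 i, Q i & E i w]) ->
  (forall i, Q i -> P (E i) <= c%:E)%E -> (P A <= (#|I|%:R * c)%:E)%E.
Proof.
move=> c0 mA mE AE EC; pose U s := \big[setU/set0]_(i <- s | Q i) E i.
have mU s : measurable (U s) by exact: bigsetU_measurable.
apply: (@le_trans _ _ (P (U (enum I)))).
  apply: le_measure; rewrite ?inE// => w /AE [i Qi Ew].
  by rewrite /U -bigcup_seq_cond; exists i => //=; rewrite mem_enum.
rewrite cardE; elim: (enum I) => [|i s IH] /=.
  by rewrite /U big_nil measure0 mul0r.
rewrite -natr1 mulrDl mul1r addrC EFinD /U big_cons; case: ifP => Qi.
  rewrite (le_trans (measureU2 _ _ _))//; first exact: mU.
  by apply: leeD => //; exact: EC.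
by rewrite -[leLHS]add0e leeD ?lee_fin.
Qed.

End finite_families.

(** * Tails of noncentral chi-square distributions *)

Section gaussian_vectors.
Context d (T : measurableType d) (R : realType) (P : probability T R).
Context (nu : nat) (Z : 'I_nu -> {RV P >-> R}).
Hypothesis indZ : mutually_independent Z.
Hypothesis normZ : forall i (A : set R), measurable A ->
  distribution P (Z i) A = normal_prob 0 1 A.

Lemma measurable_sum_sqr (theta : 'I_nu -> R) :
  measurable_fun setT (fun w => \sum_(i < nu) (Z i w + theta i) ^+ 2).
Proof.
apply: measurable_sum => i; apply: measurable_funX.
by apply: measurable_funD.
Qed.

Lemma measurable_sum_sqr_gt (theta : 'I_nu -> R) (x : R) :
  measurable [set w | x < \sum_(i < nu) (Z i w + theta i) ^+ 2].
Proof.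
rewrite [X in measurable X](_ : _ = setT `&`
  (fun w => \sum_(i < nu) (Z i w + theta i) ^+ 2) @^-1` `]x, +oo[%classic).
  by apply: measurable_sum_sqr.
by rewrite setTI; apply/seteqP; split => w /=; rewrite in_itv/= andbT.
Qed.

(* Rounding each square down to a multiple of [h] reduces a tail event of the sum
   to finitely many product events; this replaces the exponential moment of the
   sum and loses only the factor [1 - nu / K] in the exponent. *)
Lemma sqr_grid_cover (x : 'I_nu -> R) (K : nat) (h : R) : 0 < h ->
  K%:R * h < \sum_(i < nu) x i ^+ 2 ->
  exists2 m : {ffun 'I_nu -> 'I_K.+1}, (K <= \sum_i m i + nu)%N &
    forall i, (m i)%:R * h <= x i ^+ 2.
Proof.
move=> h0 Kx; pose t i := Num.truncn (x i ^+ 2 / h).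
have x2 i : (t i)%:R * h <= x i ^+ 2 < (t i).+1%:R * h.
  rewrite -ler_pdivlMr// -ltr_pdivrMr// truncn_itv//.
  by rewrite divr_ge0 ?sqr_ge0// ltW.
(* Truncation at [K] keeps the grid finite. If some [t i >= K], that coordinate alone contributes
   [K]; otherwise summing [x i ^+ 2 <= (t i + 1) h] loses at most one unit per coordinate. *)
exists [ffun i => inord (minn (t i) K)] => [|i]; last first.
  rewrite ffunE inordK ?ltnS ?geq_minr//; apply: le_trans (andP (x2 i)).1.
  by rewrite ler_pM2r// ler_nat geq_minl.
under eq_bigr do rewrite ffunE inordK ?ltnS ?geq_minr//.
have [[i Ki]|allK] := pselect (exists i, (K <= t i)%N).
  by rewrite (bigD1 i)//= (minn_idPr Ki) -addnA leq_addr.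
rewrite -(ler_nat R) -(ler_pM2r h0); apply: ltW; apply: (lt_le_trans Kx).
rewrite natrD natr_sum mulrDl mulr_suml -[nu in nu%:R]card_ord -sum1_card.
rewrite natr_sum mulr_suml -big_split/=; apply: ler_sum => i _.
rewrite (minn_idPl _); last first.
  by rewrite leqNgt; apply/negP => /ltnW ?; apply: allK; exists i.
by rewrite -mulrDl natr1 ltW// (andP (x2 i)).2.
Qed.

(** Union bound over the [(K + 1) ^ nu] grid indices: by independence the event of index [m] has
    probability at most [2 ^ nu * exp (- h * sum m / 2)], and only indices with [sum m >= K - nu]
    occur. *)
Lemma sum_sqr_upper_tail (K : nat) (h : R) : 0 < h ->
  (P [set w | (K%:R * h < \sum_(i < nu) (Z i w) ^+ 2)%R] <=
   ((K.+1 ^ nu)%:R * (2 ^+ nu * expR (- ((K%:R - nu%:R) * h / 2))))%:E)%E.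
Proof.
move=> h0.
have -> : (K.+1 ^ nu)%N = #|{ffun 'I_nu -> 'I_K.+1}|.
  by rewrite card_ffun !card_ord.
apply: (@probability_finite_cover _ _ _ _ _
  (fun m : {ffun 'I_nu -> 'I_K.+1} => K <= \sum_i m i + nu)%N
  (fun m : {ffun 'I_nu -> 'I_K.+1} =>
    [set w | forall i, ((m i)%:R * h <= Z i w ^+ 2)%R])).
- by rewrite mulr_ge0 ?expR_ge0// exprn_ge0.
- have := measurable_sum_sqr_gt (cst 0) (K%:R * h).
  by under eq_set do under eq_bigr do rewrite addr0.
- move=> m; apply: (measurable_forall_preimage Z
    (A := fun i => [set z | (m i)%:R * h <= z ^+ 2])).
  by move=> i; exact: measurable_sqr_ge.
- move=> w /= /(sqr_grid_cover h0)[m Km mx]; by exists m.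
move=> m Km; rewrite (mutually_independent_all
  (A := fun i => [set z | (m i)%:R * h <= z ^+ 2]) indZ); last first.
  by move=> i; exact: measurable_sqr_ge.
apply: (@le_trans _ _ (\prod_i (2 * expR (- ((m i)%:R * h / 2)))%:E)%E).
  apply: lee_prod => // i; rewrite normZ; last exact: measurable_sqr_ge.
  by apply: normal_prob_sqr_ge; apply: mulr_ge0 => //; exact: ltW.
rewrite prodEFin lee_fin big_split/= prodr_const card_ord ler_wpM2l ?exprn_ge0//.
rewrite -expR_sum ler_expR sumrN lerN2 -mulr_suml ler_pM2r// -mulr_suml.
by rewrite ler_pM2r// -natr_sum lerBlDr -natrD ler_nat.
Qed.

Lemma sum_sqr_lower_tail (theta : 'I_nu -> R) (k eta : R) : (0 < nu)%N ->
  0 <= k -> 0 < eta ->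
  ((normal_peak 1 ^+ nu * expR (- ((1 + eta) * (k ^+ 2 *
     \sum_(i < nu) theta i ^+ 2) + nu%:R * (1 + eta^-1)) / 2))%:E <=
   P [set w | ((1 + k) ^+ 2 * \sum_(i < nu) theta i ^+ 2 <
     \sum_(i < nu) (Z i w + theta i) ^+ 2)%R])%E.
Proof.
move=> nu0 k0 eta0; pose b i := theta i < 0.
have thetaE i : theta i = (-1) ^+ b i * `|theta i|.
  by rewrite -[LHS]mulr_sign_norm.
pose A i := [set z : R | k * `|theta i| < (-1) ^+ b i * z].
(* If every [Z i] exceeds [k * theta i] in the direction of [theta i], then every
   [|Z i + theta i|] exceeds [(1 + k) * |theta i|]. *)
apply: (@le_trans _ _ (P [set w | forall i, A i (Z i w)])); last first.
  apply: le_measure; rewrite ?inE.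
  - by apply: measurable_forall_preimage => i; exact: measurable_signed_gt.
  - exact: measurable_sum_sqr_gt.
  move=> w /= Aw; rewrite mulr_sumr.
  have Ai i : (1 + k) ^+ 2 * theta i ^+ 2 < (Z i w + theta i) ^+ 2.
    have := Aw i; rewrite /A/= => kz.
    have -> : (Z i w + theta i) ^+ 2 = ((-1) ^+ b i * Z i w + `|theta i|) ^+ 2.
      by rewrite {1}thetaE; case: (b i); rewrite ?expr0 ?expr1; ring.
    have y0 : 0 <= `|theta i| by [].
    rewrite -[theta i ^+ 2]real_normK ?num_real// -exprMn.
    have ? : 0 <= (1 + k) * `|theta i| by rewrite mulr_ge0// addr_ge0.
    by rewrite ltrXn2r// ?nnegrE; lra.
  apply: ltr_sum => //.
  by apply/hasP; exists (Ordinal nu0); rewrite ?mem_index_enum.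
rewrite mutually_independent_all//; last by move=> i; exact: measurable_signed_gt.
apply: (@le_trans _ _ (\prod_i (normal_peak 1 *
    expR (- ((k * `|theta i| + 1) ^+ 2 / 2)))%:E)%E); last first.
  apply: lee_prod => i.
    by rewrite lee_fin mulr_ge0 ?normal_peak_ge0 ?expR_ge0.
  rewrite normZ; last exact: measurable_signed_gt.
  by apply: normal_prob_halfline_ge; rewrite mulr_ge0.
rewrite prodEFin lee_fin big_split/= prodr_const card_ord.
rewrite ler_wpM2l ?exprn_ge0 ?normal_peak_ge0//.
rewrite -expR_sum ler_expR sumrN -mulr_suml mulNr lerN2 ler_pM2r//.
rewrite -[nu in nu%:R]card_ord -sum1_card natr_sum !mulr_suml !mulr_sumr.
rewrite -big_split/=; apply: ler_sum => i _.
rewrite -[theta i ^+ 2]real_normK ?num_real//.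
move: (`|theta i|) => y.
(* Completing the square absorbs the cross term [2 k y], at the price of a factor [1 + eta] close to
   1 and a constant. *)
have -> : (1 + eta) * (k ^+ 2 * y ^+ 2) + 1 * (1 + eta^-1) =
  (k * y + 1) ^+ 2 + eta * (k * y - eta^-1) ^+ 2 by field; lra.
by rewrite lerDl mulr_ge0 ?sqr_ge0// ltW.
Qed.

End gaussian_vectors.

(** * Distribution functions of chi-square laws and of the alternative *)

Section noncentral_chi2.
Context {R : realType}.
Implicit Types (mu : probability (measurableTypeR R) R) (x h : R).

Lemma law_cdfE mu x : law_cdf mu x = 1 - fine (mu `]x, +oo[%classic).
Proof.
rewrite /law_cdf -setCitvl probability_setC// fineB ?fin_num_measure//.
by rewrite opprB addrC subrK.
Qed.

Lemma chi2_null_cdf_ge nu mu (K : nat) h : is_noncentral_chi2 nu 0 mu -> 0 < h ->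
  1 - (K.+1 ^ nu)%:R * (2 ^+ nu * expR (- ((K%:R - nu%:R) * h / 2))) <=
  law_cdf mu (K%:R * h).
Proof.
move=> [d [T [P [Z [theta [indZ normZ theta0 muE]]]]]] h0.
rewrite law_cdfE lerD2l lerN2 -lee_fin fineK ?fin_num_measure// muE//.
have := sum_sqr_upper_tail indZ normZ K h0; congr (_ <= _)%E; congr (P _).
have th0 i : theta i = 0.
  apply/eqP; rewrite -sqrf_eq0.
  by move/eqP : theta0; rewrite psumr_eq0 => [/allP/(_ i)|j _];
    rewrite ?mem_index_enum ?sqr_ge0//; apply.
have sumE w : \sum_(i < nu) (Z i w + theta i) ^+ 2 = \sum_(i < nu) Z i w ^+ 2.
  by apply: eq_bigr => i _; rewrite th0 addr0.
by apply/seteqP; split => w /=; rewrite sumE in_itv/= andbT.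
Qed.

Lemma chi2_noncentral_cdf_le nu mu (delta k eta : R) : (0 < nu)%N ->
  is_noncentral_chi2 nu delta mu -> 0 <= k -> 0 < eta ->
  law_cdf mu ((1 + k) ^+ 2 * delta) <=
  1 - normal_peak 1 ^+ nu * expR (- ((1 + eta) * (k ^+ 2 * delta) +
    nu%:R * (1 + eta^-1)) / 2).
Proof.
move=> nu0 [d [T [P [Z [theta [indZ normZ thetaE muE]]]]]] k0 eta0.
rewrite law_cdfE lerD2l lerN2 -lee_fin fineK ?fin_num_measure// muE//.
have := sum_sqr_lower_tail indZ normZ theta nu0 k0 eta0.
rewrite thetaE; congr (_ <= _)%E; congr (P _).
by apply/seteqP; split => w /=; rewrite in_itv/= andbT.
Qed.

(** The infimum is a lower bound only of a set bounded below; as [F] vanishes on the negative axis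
    and [p > 0], the set is bounded below by 0. *)
Lemma quantile_le (F : R -> R) (p x : R) : 0 < p ->
  (forall y, y < 0 -> F y = 0) -> p <= F x -> quantile F p <= x.
Proof.
move=> p0 F0 px; apply: ge_inf => //; exists 0 => y /= py.
by rewrite leNgt; apply/negP => /F0 Fy; move: py; rewrite Fy leNgt p0.
Qed.

Lemma law_cdf_mono mu x y : x <= y -> law_cdf mu x <= law_cdf mu y.
Proof.
move=> xy; rewrite fine_le ?fin_num_measure// le_measure ?inE//.
exact: subitvPr.
Qed.

Lemma chi2_null_cdf_lt0 nu mu x : is_noncentral_chi2 nu 0 mu -> x < 0 ->
  law_cdf mu x = 0.
Proof.
move=> [d [T [P [Z [theta [_ _ _ muE]]]]]] x0; rewrite /law_cdf muE//.
rewrite [X in P X](_ : _ = set0) ?measure0//.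
apply/seteqP; split => w //=; rewrite in_itv/= => /le_lt_trans/(_ x0).
by rewrite ltNge sumr_ge0// => i _; exact: sqr_ge0.
Qed.

(** By monotonicity any upper bound [x] of the null quantile can replace it, so the quantile is
    never computed exactly. *)
Lemma alt_cdf_ge (e u x : R) nu (mu0 mu1 : probability (measurableTypeR R) R) :
  is_noncentral_chi2 nu 0 mu0 -> 0 <= e -> u < 1 -> 1 - u <= law_cdf mu0 x ->
  u + e * ((1 - law_cdf mu1 x) - u) <=
  alt_cdf e (law_cdf mu0) (law_cdf mu1) u.
Proof.
move=> hmu0 e0 u1 ux; rewrite /alt_cdf lerD2l ler_wpM2l//.
rewrite [1 - u - _]addrAC lerB// lerB// law_cdf_mono//.
apply: quantile_le => //; first by rewrite subr_gt0.
by move=> y; exact: (chi2_null_cdf_lt0 hmu0).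
Qed.

End noncentral_chi2.

(** * The empirical process *)

Section empirical.
Context d (T : measurableType d) (R : realType) (P : probability T R).
Context (n : nat) (A : 'I_n -> set T) (H : R).
Hypothesis mA : forall i, measurable (A i).
Hypothesis PA : forall i, P (A i) = H%:E.
Hypothesis PAA : forall i j, i != j -> P (A i `&` A j) = (H ^+ 2)%:E.

Let N w : R := \sum_(i < n) \1_(A i) w.

Let mN : measurable_fun setT N.
Proof. by apply: measurable_sum => i; exact: measurable_indic. Qed.

Let N0 w : 0 <= N w. Proof. by apply: sumr_ge0 => i _; rewrite indicE. Qed.

Let H0 (i : 'I_n) : 0 <= H. Proof. by rewrite -lee_fin -(PA i). Qed.

Let integral_N : (\int[P]_w (N w)%:E = (n%:R * H)%:E)%E.
Proof.
under eq_integral do rewrite /N -sumEFin.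
rewrite ge0_integral_sum//=.
- rewrite (eq_bigr (fun=> H%:E)) => [|i _].
    by rewrite sumEFin sumr_const card_ord mulr_natl.
  by rewrite integral_indic// setIT; exact: PA.
- by move=> i; apply/measurable_EFinP; exact: measurable_indic.
Qed.

(** Diagonal pairs contribute [H] and the others [H ^+ 2]; adding [H ^+ 2] on the diagonal too gives
    a bound that makes the variance at most the mean. *)
Let integral_sqr_N :
  (\int[P]_w (N w ^+ 2)%:E <= (n%:R * H + (n%:R * H) ^+ 2)%:E)%E.
Proof.
have NE w : (N w ^+ 2)%:E = (\sum_(i < n) \sum_(j < n) (\1_(A i `&` A j) w)%:E)%E.
  rewrite /N expr2 mulr_suml -sumEFin; apply: eq_bigr => i _.
  rewrite mulr_sumr -sumEFin; apply: eq_bigr => j _.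
  by rewrite indicI.
under eq_integral do rewrite NE.
have mI i j : measurable_fun setT (fun w => (\1_(A i `&` A j) w)%:E).
  by apply/measurable_EFinP; apply: measurable_indic; exact: measurableI.
rewrite ge0_integral_sum//=; last 2 first.
- by move=> i; exact: emeasurable_sum.
- by move=> i w _; exact: sume_ge0.
have -> : n%:R * H + (n%:R * H) ^+ 2 =
    \sum_(i < n) (H + n%:R * H ^+ 2) :> R.
  by rewrite sumr_const card_ord -mulr_natl; ring.
rewrite -sumEFin; apply: lee_sum => i _.
rewrite ge0_integral_sum//=.
rewrite (bigD1 i)//= EFinD; apply: leeD.
  by rewrite integral_indic ?setIT ?setIid//= PA.
apply: (@le_trans _ _ (\sum_(j < n) (H ^+ 2)%:E)%E); last first.
  by rewrite sumEFin sumr_const card_ord mulr_natl.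
rewrite [leRHS](bigD1 i)//= -[leLHS]add0e.
apply: leeD; first by rewrite lee_fin sqr_ge0.
apply: lee_sum => j ji.
rewrite integral_indic ?setIT//=; last exact: measurableI.
by rewrite PAA// eq_sym.
Qed.

Lemma count_chebyshev (c : R) : 0 < c ->
  (P [set w | (N w <= n%:R * H - c)%R] <= (n%:R * H / c ^+ 2)%:E)%E.
Proof.
move=> c0; set m := n%:R * H.
have m0 : 0 <= m.
  (* For [n = 0] there is no index from which to read [0 <= H], but then the mean is 0. *)
  rewrite /m; case: n A mA PA H0 => [|k] ? _ _; first by rewrite mul0r.
  by move/(_ ord0) => ?; rewrite mulr_ge0.
have V : (\int[P]_w ((N w - m) ^+ 2)%:E <= m%:E)%E.
  have := integral_sqr_N; rewrite -/m => N2.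
  (* Adding [2 m ^ 2], the integral of [2 m N], to both sides leaves only nonnegative integrands:
     [(N - m) ^ 2 + 2 m N = N ^ 2 + m ^ 2]. *)
  rewrite -(@leeD2rE _ (2 * m * m)%:E)//.
  have E2 : ((2 * m * m)%:E = \int[P]_w (2 * m * N w)%:E)%E.
    under eq_integral do rewrite EFinM.
    rewrite ge0_integralZl//=.
    - by rewrite integral_N.
    - exact/measurable_EFinP.
    - by move=> w _; rewrite lee_fin.
    - by rewrite lee_fin mulr_ge0.
  rewrite [in leLHS]E2 -ge0_integralD//=; last 4 first.
  - by move=> w _; rewrite lee_fin sqr_ge0.
  - by apply/measurable_EFinP/measurable_funX/measurable_funB.
  - by move=> w _; rewrite lee_fin mulr_ge0// mulr_ge0.
  - by apply/measurable_EFinP/measurable_funM.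
  rewrite (eq_integral (fun w => (N w ^+ 2)%:E + (m ^+ 2)%:E)%E); last first.
    by move=> w _; rewrite -!EFinD; congr EFin; ring.
  rewrite ge0_integralD//=; last 3 first.
  - by move=> w _; rewrite lee_fin sqr_ge0.
  - by apply/measurable_EFinP/measurable_funX.
  - by move=> w _; rewrite lee_fin sqr_ge0.
  rewrite integral_cst//= probability_setT mule1.
  rewrite (le_trans (leeD2r _ N2))// -!EFinD lee_fin.
  by lra.
have mE : measurable [set w | N w <= m - c].
  rewrite [X in measurable X](_ : _ = setT `&` N @^-1` `]-oo, m - c]%classic).
    exact: mN.
  by rewrite setTI; apply/seteqP; split => w /=; rewrite in_itv.
rewrite EFinM lee_pdivlMr ?exprn_gt0// muleC; apply: le_trans V.
have -> : P [set w | N w <= m - c] =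
    (\int[P]_w (\1_[set w | (N w <= m - c)%R] w)%:E)%E.
  by rewrite integral_indic// setIT.
rewrite -ge0_integralZl//=; last 2 first.
- by apply/measurable_EFinP; exact: measurable_indic.
- by rewrite lee_fin sqr_ge0.
apply: ge0_le_integral => //=.
- by move=> w _; rewrite -EFinM lee_fin mulr_ge0 ?sqr_ge0.
- by apply: measurable_funeM; apply/measurable_EFinP; exact: measurable_indic.
- by apply/measurable_EFinP/measurable_funX/measurable_funB.
move=> w _; rewrite -EFinM lee_fin indicE.
have [|] := boolP (w \in _); rewrite ?mulr0 ?sqr_ge0// inE/= mulr1 => Nw.
by nra.
Qed.
End empirical.

(** * The weight function [q] *)

Section weight.
Context {R : realType}.
Implicit Types (u : R).

Lemma expR1_lt4 : expR 1 < 4 :> R.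
Proof.
have h : 2^-1 < expR (- 2^-1) :> R.
  by apply: le_lt_trans (@expR_gt1Dx R _ _); [lra|rewrite oppr_eq0 invr_eq0].
have -> : (1 : R) = 2^-1 + 2^-1 by lra.
rewrite expRD; move: h; rewrite expRN ltf_pV2 ?posrE ?expR_gt0// => h.
have := @expR_gt0 R 2^-1; nra.
Qed.

(** Since [u (1 - u) <= 1/4 < 1/e]; hence the iterated logarithm in [q] is positive. *)
Lemma ln_ge_gt1 u : 0 < u < 1 -> 1 < ln (u * (1 - u))^-1.
Proof.
move=> u01; have v0 : 0 < u * (1 - u) by nra.
rewrite -ltr_expR lnK ?posrE ?invr_gt0//; apply: lt_le_trans expR1_lt4 _.
rewrite -[4]invrK lef_pV2 ?posrE ?invr_gt0//.
by have := sqr_ge0 (u - 2^-1); nra.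
Qed.

Lemma q_gt0 u : 0 < u < 1 -> 0 < q u.
Proof.
move=> u01; rewrite /q sqrtr_gt0; apply: mulr_gt0; first by nra.
by apply: ln_gt0; exact: ln_ge_gt1.
Qed.

Lemma q_continuous u : 0 < u < 1 -> {for u, continuous (@q R)}.
Proof.
move=> u01; have v0 : 0 < u * (1 - u) by nra.
have vE : (fun x : R => x * (1 - x)) x @[x --> u] --> u * (1 - u).
  by apply: cvgM => //; apply: cvgB => //; exact: cvg_cst.
have l1 := ln_ge_gt1 u01.
apply: continuous_cvg; first exact: sqrt_continuous.
apply: cvgM => //; apply: continuous_cvg; first by apply: continuous_ln; lra.
apply: continuous_cvg; first by apply: continuous_ln; rewrite invr_gt0.
by apply: cvgV => //; rewrite gt_eqF.
Qed.

End weight.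

Lemma indic_preimage_le {T : Type} {R : realType} (f : T -> R) (u : R) w :
  \1_(f @^-1` `]-oo, u]%classic) w = (f w <= u)%R%:R :> R.
Proof.
rewrite indicE; have -> // : (w \in f @^-1` `]-oo, u]%classic) = (f w <= u).
by apply/idP/idP; rewrite inE/= in_itv.
Qed.

(** * Measurability of the statistic *)

Section Tplus_measurable.
Context d (T : measurableType d) (R : realType) (P : probability T R).
Context (n : nat) (X : 'I_n -> {RV P >-> R}).

Let f (u : R) w := Num.sqrt n%:R * (empirical_cdf (fun i => X i w) u - u) / q u.

Lemma empirical_cdf_mono (s : 'I_n -> R) (u v : R) : u <= v ->
  empirical_cdf s u <= empirical_cdf s v.
Proof.
move=> uv; rewrite /empirical_cdf ler_wpM2l//; apply: ler_sum => i _.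
by rewrite ler_nat; case: leP => // su; rewrite (le_trans su uv).
Qed.

Lemma measurable_empirical_cdf u :
  measurable_fun setT (fun w => empirical_cdf (fun i => X i w) u).
Proof.
apply: measurable_funM => //; apply: measurable_sum => i.
rewrite (_ : (fun w => _) = \1_(X i @^-1` `]-oo, u]%classic)).
  apply: measurable_indic; rewrite -[X in measurable X]setTI.
  exact: measurable_funP.
by apply/funext => w; rewrite indic_preimage_le.
Qed.

(* Between jumps the statistic is continuous, and a jump of the empirical cdf can
   only increase it, so the supremum may be taken over the rationals. *)
Lemma exists_rat_gt u a w : 0 < u < 1 -> a < f u w ->
  exists2 p : rat, 0 < (ratr p : R) < 1 & a < f (ratr p) w.
Proof.
move=> u01 afu.
(* [g] freezes the empirical cdf at its value at [u], so it is continuous there; to the right of [u]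
   it is a lower bound for the process. *)
pose g x := Num.sqrt n%:R * (empirical_cdf (fun i => X i w) u - x) / q x.
have : g x @[x --> u] --> g u.
  apply: cvgM; last by apply: cvgV; [rewrite gt_eqF// q_gt0|exact: q_continuous].
  by apply: cvgM; [exact: cvg_cst|apply: cvgB => //; exact: cvg_cst].
move=> /cvgr_gt /(_ a afu) /nbhs_ballP[e /= e0 ug].
have /rat_in_itvoo[p] : u < Num.min (u + e) 1.
  by rewrite lt_min; lra.
rewrite in_itv/= lt_min => /and3P[up pue p1].
exists p; first lra.
apply: (lt_le_trans (ug (ratr p) _)).
  by rewrite /ball/= ltr_norml; lra.
have qp : 0 < q (ratr p : R) by apply: q_gt0; lra.
by rewrite /f /g ler_pM2r ?invr_gt0// ler_wpM2l// lerB// empirical_cdf_mono// ltW.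
Qed.

Lemma measurable_Tplus_ge t :
  measurable [set w | (t%:E <= Tplus (fun i => X i w))%E].
Proof.
(* The supremum need not be attained, so every level [t - 1 / (k + 1)] must be exceeded at some
   rational. *)
have -> : [set w | (t%:E <= Tplus (fun i => X i w))%E] =
    \bigcap_k \bigcup_(p in [set p : rat | 0 < (ratr p : R) < 1])
      [set w | t - k.+1%:R^-1 < f (ratr p) w].
  apply/seteqP; split => w /=.
    move=> tT k _; have : ((t - k.+1%:R^-1)%:E < Tplus (fun i => X i w))%E.
      by apply: lt_le_trans tT; rewrite lte_fin ltrBlDr ltrDl invr_gt0.
    move=> /ereal_sup_gt[_ [u u01 <-]]; rewrite lte_fin.
    rewrite /= in_itv/= in u01.
    by move=> /(exists_rat_gt u01)[p p01 ?]; exists p.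
  move=> h; apply/lee_subgt0Pr => e e0.
  have [k ke] : exists k : nat, k.+1%:R^-1 < e.
    by have [k] := ltr_add_invr e0; rewrite add0r; exists k.
  have [p /= p01 tf] := h k I.
  apply: (@le_trans _ _ (f (ratr p) w)%:E).
    by rewrite -EFinB lee_fin (le_trans _ (ltW tf))// lerB// ltW.
  by apply: ereal_sup_ubound; exists (ratr p) => //=; rewrite in_itv.
apply: bigcapT_measurable => k; rewrite bigcup_mkcond.
apply: bigcupT_measurable_rat => p; case: ifP => // _.
rewrite [X in measurable X](_ : _ = setT `&`
  (f (ratr p)) @^-1` `]t - k.+1%:R^-1, +oo[%classic).
  apply: measurable_funM => //; apply: measurable_funM => //.
  by apply: measurable_funB => //; exact: measurable_empirical_cdf.
by rewrite setTI; apply/seteqP; split => w /=; rewrite in_itv/= andbT.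
Qed.

End Tplus_measurable.

(** * Power from one point of the empirical process *)

Section empirical_process.
Context d (T : measurableType d) (R : realType) (P : probability T R).
Context (n : nat) (X : 'I_n -> {RV P >-> R}).
Hypothesis indX : mutually_independent X.

Lemma empirical_cdf_le (u H c : R) : (0 < n)%N -> 0 < c ->
  (forall i, cdf (X i) u = H%:E) ->
  (P [set w | (empirical_cdf (fun i => X i w) u <= H - c)%R] <=
    (H / (n%:R * c ^+ 2))%:E)%E.
Proof.
move=> n0 c0 cdfX; have n0' : 0 < n%:R :> R by rewrite ltr0n.
pose A i := X i @^-1` `]-oo, u]%classic.
have mA i : measurable (A i).
  by rewrite -[A i]setTI; exact: measurable_funP.
have PA i : P (A i) = H%:E by rewrite -(cdfX i).
have PAA i j : i != j -> P (A i `&` A j) = (H ^+ 2)%:E.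
  move=> ij; have := indX (J := [set i; j]%SET) (A := fun=> `]-oo, u]%classic).
  rewrite big_setU1 ?inE//= big_set1 -!/(A _) !PA -EFinM -expr2 => <-//.
  congr (P _); apply/seteqP; split => w.
    by move=> [Ai Aj] k /=; rewrite !inE => /orP[/eqP->|/eqP->].
  by move=> Aij; split; apply: Aij; rewrite /= !inE eqxx ?orbT.
have := count_chebyshev mA PA PAA (c := n%:R * c).
rewrite mulr_gt0// => /(_ isT).
have -> : n%:R * H / (n%:R * c) ^+ 2 = H / (n%:R * c ^+ 2).
  by field; rewrite !gt_eqF.
congr (_ <= _)%E; congr (P _).
have cE w : \sum_(i < n) \1_(A i) w = \sum_(i < n) (X i w <= u)%R%:R :> R.
  by apply: eq_bigr => i _; rewrite indic_preimage_le.
by apply/seteqP; split => w /=; rewrite /empirical_cdf -mulrBr ler_pdivrMl// cE.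
Qed.

(** Let [D' = H - u]. Outside an event of probability at most [4 H / (n D' ^ 2)] the empirical cdf
    at [u] exceeds [u] by at least [D' / 2], which beats the threshold. Writing [H = u + D'] splits
    this bound into two terms decreasing in [D'], so [D] may replace [D']. *)
Lemma Tplus_power (t u H D : R) : (0 < n)%N -> 0 < u < 1 ->
  (forall i, cdf (X i) u = H%:E) -> 0 < D -> u + D <= H ->
  t * q u <= Num.sqrt n%:R * (D / 2) ->
  ((1 - (4 * u / (n%:R * D ^+ 2) + 4 / (n%:R * D)))%:E <=
    P [set w | (t%:E <= Tplus (fun i => X i w))%E])%E.
Proof.
move=> n0 u01 cdfX D0 uDH tq; have n0' : 0 < n%:R :> R by rewrite ltr0n.
set E := [set w | _].
have mE : measurable E by exact: measurable_Tplus_ge.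
pose D' := H - u; have DD' : D <= D' by rewrite /D'; lra.
have D'0 : 0 < D' by lra.
have := @empirical_cdf_le u H (D' / 2) n0 _ cdfX.
rewrite divr_gt0// => /(_ isT); set F := [set w | _] => PF.
have mF : measurable F.
  rewrite /F [X in measurable X](_ : _ = setT `&`
    (fun w => empirical_cdf (fun i => X i w) u) @^-1` `]-oo, H - D' / 2]%classic).
    exact: measurable_empirical_cdf.
  by rewrite setTI; apply/seteqP; split => w /=; rewrite in_itv.
have EF : ~` F `<=` E.
  move=> w /negP; rewrite -ltNge => uF; apply: (@le_trans _ _
    (Num.sqrt n%:R * (empirical_cdf (fun i => X i w) u - u) / q u)%:E); last first.
    by apply: ereal_sup_ubound; exists u => //=; rewrite in_itv.
  rewrite lee_fin ler_pdivlMr ?q_gt0//; apply: (le_trans tq).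
  by rewrite ler_wpM2l//; rewrite /D' in uF; lra.
apply: (@le_trans _ _ (P (~` F))); last first.
  by apply: le_measure; rewrite ?inE//; exact: measurableC.
rewrite probability_setC// EFinB leeB//; apply: (le_trans PF).
rewrite lee_fin (_ : H = u + D'); last by rewrite /D'; ring.
rewrite [leLHS](_ : _ = 4 * u / (n%:R * D' ^+ 2) + 4 / (n%:R * D')); last first.
  by field; rewrite !gt_eqF.
apply: lerD.
  rewrite ler_pM2l; last by lra.
  by rewrite lef_pV2 ?posrE ?mulr_gt0 ?exprn_gt0// ler_pM2l// lerXn2r// nnegrE ltW.
by rewrite ler_pM2l// lef_pV2 ?posrE ?mulr_gt0 ?exprn_gt0// ler_pM2l.
Qed.
End empirical_process.

(** * Asymptotics *)

Section asymptotics.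
Context {R : realType}.
Implicit Types (b C s L beta r tau sigma kappa : R).

(** For [x >= 0], [exp x >= (x / 2) ^ 2], and a quadratic outgrows an affine function. *)
Lemma expR_ge_affine b C s : 0 < b -> 0 <= C -> 0 <= s ->
  exists L0 : R, forall L, L0 <= L -> C * (s * L + 1) <= expR (b * L).
Proof.
move=> b0 C0 s0; exists (1 + 4 * C * (s + 1) / b ^+ 2) => L LL0.
have M0 : 0 <= 4 * C * (s + 1) / b ^+ 2.
  by rewrite divr_ge0 ?sqr_ge0// !mulr_ge0// addr_ge0.
have L1 : 1 <= L by lra.
have CL : 4 * C * (s + 1) <= L * b ^+ 2.
  by rewrite -ler_pdivrMr ?exprn_gt0//; lra.
apply: (@le_trans _ _ ((b * L / 2) ^+ 2)).
  have -> : (b * L / 2) ^+ 2 = (L * b ^+ 2) * L / 4 by field.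
  apply: (@le_trans _ _ (4 * C * (s + 1) * L / 4)); last first.
    by rewrite ler_pM2r// ler_pM2r//; lra.
  have -> : 4 * C * (s + 1) * L / 4 = C * ((s + 1) * L) by field.
  by rewrite ler_wpM2l//; lra.
have h0 : 0 <= b * L / 2 by rewrite divr_ge0// mulr_ge0; lra.
rewrite [b * L in leRHS](_ : _ = b * L / 2 + b * L / 2); last by field.
rewrite expRD -expr2 lerXn2r ?nnegrE ?expR_ge0//.
by apply: le_trans (expR_ge1Dx _); lra.
Qed.

Lemma expR_ge_cst b C : 0 < b ->
  exists L0 : R, forall L, L0 <= L -> C <= expR (b * L).
Proof.
move=> b0; have [L0 hL0] := expR_ge_affine b0 (normr_ge0 C) (lexx 0).
exists L0 => L /hL0; rewrite mul0r add0r mulr1.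
exact: le_trans (ler_norm _).
Qed.

Lemma detection_parameters beta r : 1 / 2 < beta < 1 -> 0 < r < 1 ->
  rho beta < r ->
  exists sigma kappa, [/\ Num.sqrt r <= sigma, (sigma - Num.sqrt r) ^+ 2 < kappa,
    kappa < sigma ^+ 2, kappa < 1 - beta & 2 * beta + 2 * kappa < sigma ^+ 2 + 1].
Proof.
move=> beta01 r01 hrho; set tau := Num.sqrt r.
have tau0 : 0 < tau by rewrite sqrtr_gt0; lra.
have tau2 : tau ^+ 2 = r by rewrite sqr_sqrtr//; lra.
have tau1 : tau < 1 by nra.
pose l := Num.sqrt (1 - beta).
have l0 : 0 < l by rewrite sqrtr_gt0; lra.
have l2 : l ^+ 2 = 1 - beta by rewrite sqr_sqrtr//; lra.
suff [sigma [ts h1 h2 h3]] : exists sigma, [/\ tau <= sigma,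
    (sigma - tau) ^+ 2 < sigma ^+ 2, (sigma - tau) ^+ 2 < 1 - beta &
    2 * beta + 2 * (sigma - tau) ^+ 2 < sigma ^+ 2 + 1].
  (* [M] is the least of the three strict upper bounds on [kappa], which is taken midway between
     [(sigma - tau) ^+ 2] and [M]. *)
  pose M := Num.min (sigma ^+ 2) (Num.min (1 - beta)
    ((sigma ^+ 2 + 1 - 2 * beta) / 2)).
  have hM : (sigma - tau) ^+ 2 < M by rewrite !lt_min h1 h2/=; lra.
  have := lexx M; rewrite {2}/M !le_min => /and3P[M1 M2 M3].
  by exists sigma, (((sigma - tau) ^+ 2 + M) / 2); split=> //; lra.
move: hrho; rewrite /rho -/l.
have [beta34 hrho|beta34 hrho] := ltP beta (3 / 4); last first.
  (* With [sigma = 1] the last two constraints both say [(1 - tau) ^ 2 < 1 - beta], that is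
     [rho beta < r] after taking roots. *)
  exists 1; have : 1 - l < tau.
    have l1 : l <= 1 by nra.
    by nra.
  by split; nra.
(* [sigma ^+ 2 / 2 - (sigma - tau) ^+ 2] is maximal at [sigma = 2 * tau], which is
   admissible as long as [2 * tau <= 1]. *)
have [r14|r14] := ltP r (1 / 4).
  by exists (2 * tau); split; nra.
(* Here [(1 - tau) ^ 2 <= 1/4 < 1 - beta]. *)
exists 1; have t12 : 1 / 2 <= tau by nra.
by split; nra.
Qed.

(** One logarithm is dropped by [ln x <= x], which is harmless against a polynomial gain; [u <= 1/2]
    gives [1 / (1 - u) <= 2 <= e]. *)
Lemma q_le (u : R) : 0 < u <= 1 / 2 -> q u ^+ 2 <= u * (1 - ln u).
Proof.
move=> u01; have u01' : 0 < u < 1 by lra.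
have l1 := ln_ge_gt1 u01'; have v0 : 0 < u * (1 - u) by nra.
rewrite /q sqr_sqrtr; last first.
  by apply: mulr_ge0; [exact: ltW|apply/ltW/ln_gt0].
rewrite -mulrA ler_wpM2l//; first lra.
apply: (@le_trans _ _ (ln (ln (u * (1 - u))^-1))).
  by rewrite ler_piMl//; [apply/ltW/ln_gt0|lra].
apply: (@le_trans _ _ (ln (u * (1 - u))^-1)).
  by apply/ltW/ln_sublinear; lra.
rewrite lnV ?posrE// lnM ?posrE; [|lra|lra].
rewrite opprD addrC lerD2r -ler_expR expRN lnK ?posrE; last lra.
apply: (@le_trans _ _ 2); last by have := @expR_ge1Dx R 1; lra.
by rewrite -[2]invrK lef_pV2 ?posrE; lra.
Qed.

(** The noncentral tail beyond a bound [x] of the null quantile is at least [exp (- kappa L)]; half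
    of it pays for the subtracted [u]. *)
Lemma alt_cdf_gain nu (chi2 : R -> probability (measurableTypeR R) R) r
    sigma kappa : (0 < nu)%N ->
  (forall delta : R, 0 <= delta -> is_noncentral_chi2 nu delta (chi2 delta)) ->
  0 < r -> Num.sqrt r <= sigma -> (sigma - Num.sqrt r) ^+ 2 < kappa ->
  kappa < sigma ^+ 2 ->
  exists L0 : R, forall L, L0 <= L -> forall e, 0 <= e ->
    expR (- (sigma ^+ 2 * L)) + e * (expR (- (kappa * L)) / 2) <=
    alt_cdf e (law_cdf (chi2 0)) (law_cdf (chi2 (2 * r * L)))
      (expR (- (sigma ^+ 2 * L))).
Proof.
move=> nu0 hchi2 r0; set tau := Num.sqrt r => tau_sigma hkappa kappa_sigma.
have tau0 : 0 < tau by rewrite sqrtr_gt0.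
have tau2 : tau ^+ 2 = r by rewrite sqr_sqrtr// ltW.
have sigma0 : 0 < sigma by exact: lt_le_trans tau0 tau_sigma.
pose g := Num.sqrt kappa.
have kappa0 : 0 < kappa by apply: le_lt_trans hkappa; rewrite sqr_ge0.
have g0 : 0 < g by rewrite sqrtr_gt0.
have g2 : g ^+ 2 = kappa by rewrite sqr_sqrtr// ltW.
have gst : sigma - tau < g.
  by rewrite -g2 in hkappa; nra.
(* Midway between [sigma - tau] and [sqrt kappa]: [sigma' = tau + m > sigma] leaves room for the
   null tail, [m ^+ 2 < kappa] for the noncentral one. *)
pose m := (g + (sigma - tau)) / 2.
have m0 : 0 < m by rewrite /m; lra.
have mg : m ^+ 2 < kappa by rewrite -g2 ltrXn2r// ?nnegrE /m; lra.
pose sigma' := tau + m.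
have ss' : sigma ^+ 2 < sigma' ^+ 2 by rewrite ltrXn2r// ?nnegrE /sigma' /m; lra.
(* Chosen so that [(1 + eta) m ^ 2] is midway between [m ^ 2] and [kappa]. *)
pose eta := (kappa / m ^+ 2 - 1) / 2.
have eta0 : 0 < eta.
  by rewrite /eta divr_gt0// subr_gt0 ltr_pdivlMr ?exprn_gt0// mul1r.
have etam : (1 + eta) * m ^+ 2 = (m ^+ 2 + kappa) / 2.
  by rewrite /eta; field; rewrite gt_eqF.
(* The grid is fine enough that [(1 - nu / K) sigma' ^ 2] still exceeds [sigma ^ 2]. *)
pose K := (Num.truncn (nu%:R * sigma' ^+ 2 / (sigma' ^+ 2 - sigma ^+ 2))).+1.
have K0 : 0 < K%:R :> R by rewrite ltr0n.
have hK : 0 < (1 - nu%:R / K%:R) * sigma' ^+ 2 - sigma ^+ 2.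
  have : nu%:R * sigma' ^+ 2 / (sigma' ^+ 2 - sigma ^+ 2) < K%:R.
    by apply: truncnS_gt.
  rewrite ltr_pdivrMr; last by rewrite subr_gt0.
  move=> h.
  have -> : (1 - nu%:R / K%:R) * sigma' ^+ 2 - sigma ^+ 2 =
    (K%:R * (sigma' ^+ 2 - sigma ^+ 2) - nu%:R * sigma' ^+ 2) / K%:R.
    by field; rewrite gt_eqF.
  by rewrite divr_gt0// subr_gt0.
pose C0 : R := (K.+1 ^ nu)%:R * 2 ^+ nu.
(* [L1] and [L2] absorb the prefactors of the null and noncentral tails; [L3] ensures
   [2 u <= exp (- kappa L)]. *)
have [L1 hL1] := expR_ge_cst C0 hK.
pose c1 : R := normal_peak 1 ^+ nu * expR (- (nu%:R * (1 + eta^-1)) / 2).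
have c10 : 0 < c1 by rewrite mulr_gt0 ?expR_gt0// exprn_gt0// normal_peak_gt0.
have km0 : 0 < (kappa - m ^+ 2) / 2 by lra.
have [L2 hL2] := expR_ge_cst c1^-1 km0.
have ks0 : 0 < sigma ^+ 2 - kappa by lra.
have [L3 hL3] := expR_ge_cst 2 ks0.
exists (Num.max 1 (Num.max L1 (Num.max L2 L3))) => L.
rewrite !ge_max => /and4P[L_ge1 /hL1 {}hL1 /hL2 {}hL2 /hL3 {}hL3] e e0.
have L0 : 0 < L by lra.
set u := expR (- (sigma ^+ 2 * L)); pose x := sigma' ^+ 2 * (2 * L).
have hx0 : 1 - u <= law_cdf (chi2 0) x.
  have h0 : 0 < x / K%:R.
    by rewrite divr_gt0// mulr_gt0 ?mulr_gt0 ?exprn_gt0 ?addr_gt0.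
  have := chi2_null_cdf_ge K (hchi2 0 (lexx 0)) h0.
  rewrite [K%:R * (x / _)]mulrC divfK ?gt_eqF//; apply: le_trans.
  rewrite lerD2l lerN2 mulrA -/C0.
  rewrite (_ : (K%:R - nu%:R) * (x / K%:R) / 2 =
    ((1 - nu%:R / K%:R) * sigma' ^+ 2 - sigma ^+ 2) * L + sigma ^+ 2 * L); last first.
    by rewrite /x; field; rewrite gt_eqF.
  rewrite opprD expRD mulrA ler_piMl ?expR_ge0// expRN ler_pdivrMr ?expR_gt0//.
  by rewrite mul1r.
have u1 : u < 1 by rewrite /u expR_lt1 oppr_lt0 mulr_gt0// exprn_gt0.
have d0 : 0 <= 2 * r * L by rewrite !mulr_ge0// ltW.
apply: le_trans (alt_cdf_ge (chi2 (2 * r * L)) (hchi2 0 (lexx 0)) e0 u1 hx0).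
rewrite lerD2l ler_wpM2l//.
have k0 : 0 <= m / tau by rewrite divr_ge0// ltW.
have := chi2_noncentral_cdf_le nu0 (hchi2 _ d0) k0 eta0.
have -> : (1 + m / tau) ^+ 2 * (2 * r * L) = x.
  by rewrite /x /sigma' -tau2; field; rewrite gt_eqF.
have -> : (m / tau) ^+ 2 * (2 * r * L) = m ^+ 2 * (2 * L).
  by rewrite -tau2; field; rewrite gt_eqF.
rewrite (_ : - _ / 2 = - (nu%:R * (1 + eta^-1)) / 2 +
  ((kappa - m ^+ 2) / 2 * L + - (kappa * L))); last first.
  by rewrite [(1 + eta) * _]mulrA etam; field; rewrite gt_eqF.
rewrite expRD mulrA -/c1 expRD mulrA => hx.
have p1 : 1 * expR (- (kappa * L)) <=
    c1 * expR ((kappa - m ^+ 2) / 2 * L) * expR (- (kappa * L)).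
  by rewrite ler_pM2r ?expR_gt0// -ler_pdivrMl// mulr1.
have pu : u * 2 <= expR (- (kappa * L)).
  rewrite /u (_ : - (kappa * L) =
    - (sigma ^+ 2 * L) + (sigma ^+ 2 - kappa) * L); last by ring.
  by rewrite expRD ler_pM2l ?expR_gt0.
lra.
Qed.

End asymptotics.

(** * Power along the sequence of alternatives *)

Section power.
Context {R : realType}.

Lemma near_ln_ge (L0 : R) : \forall n \near \oo, L0 <= ln (n%:R : R).
Proof.
near=> n; have nL : expR L0 <= n%:R.
  by near: n; exact: nbhs_infty_ger.
by rewrite -ler_expR lnK// posrE (lt_le_trans (expR_gt0 L0)).
Unshelve. all: by end_near. Qed.

(** The rank depends on [e] but not on the probability space or the sample, so the bound applies
    when the space changes with [n]. *)
Lemma detection_power nu (chi2 : R -> probability (measurableTypeR R) R)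
    (beta r t e : R) : (0 < nu)%N ->
  (forall delta : R, 0 <= delta -> is_noncentral_chi2 nu delta (chi2 delta)) ->
  1 / 2 < beta < 1 -> 0 < r < 1 -> rho beta < r -> 0 < e ->
  \forall n \near \oo, forall d (T : measurableType d) (P : probability T R)
    (X : 'I_n -> {RV P >-> R}), mutually_independent X ->
    (forall i (u : R), 0 < u < 1 -> cdf (X i) u =
      (alt_cdf (eps beta n) (law_cdf (chi2 0)) (law_cdf (chi2 (dlt r n))) u)%:E) ->
    ((1 - e)%:E <= P [set w | (t%:E <= Tplus (fun i => X i w))%E])%E.
Proof.
move=> nu0 hchi2 beta01 r01 hrho e0.
(* The process is evaluated at [u = n ^ (- sigma ^ 2)], where the cdf exceeds [u]
   by at least [D = n ^ (- beta - kappa) / 2]. *)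
have [sigma [kappa [ts h1 h2 h3 h4]]] := detection_parameters beta01 r01 hrho.
have r0 : 0 < r by lra.
have tau0 : 0 < Num.sqrt r by rewrite sqrtr_gt0.
have sigma0 : 0 < sigma by exact: lt_le_trans tau0 ts.
have s2 : 0 < sigma ^+ 2 by rewrite exprn_gt0.
have [L1 hL1] := alt_cdf_gain nu0 hchi2 r0 ts h1 h2.
(* Up to constants, [n D] is [n ^ a] and [n D ^ 2 / u] is [n ^ b]. *)
pose a := 1 - beta - kappa; have a0 : 0 < a by rewrite /a; lra.
pose b := sigma ^+ 2 + 1 - 2 * beta - 2 * kappa.
have b0 : 0 < b by rewrite /b; lra.
(* The Chebyshev terms will be [16 exp (- b L)] and [8 exp (- a L)], each to be at most [e / 2];
   [L4] gives [u <= 1/2] and [L5] beats the critical value. *)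
have [L2 hL2] := expR_ge_cst (32 / e) b0.
have [L3 hL3] := expR_ge_cst (16 / e) a0.
have [L4 hL4] := expR_ge_cst 2 s2.
have t0 : 0 <= 16 * t ^+ 2 by rewrite mulr_ge0// sqr_ge0.
have [L5 hL5] := expR_ge_affine b0 t0 (ltW s2).
near=> n => d T P X indX cdfX.
have n0 : (0 < n)%N by near: n; exact: nbhs_infty_gt.
have nE : n%:R = expR (ln n%:R) :> R by rewrite lnK// posrE ltr0n.
have hL0 : L1 <= ln (n%:R : R) by near: n; exact: near_ln_ge.
have {}/hL2 hL2 : L2 <= ln (n%:R : R) by near: n; exact: near_ln_ge.
have {}/hL3 hL3 : L3 <= ln (n%:R : R) by near: n; exact: near_ln_ge.
have {}/hL4 hL4 : L4 <= ln (n%:R : R) by near: n; exact: near_ln_ge.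
have {}/hL5 hL5 : L5 <= ln (n%:R : R) by near: n; exact: near_ln_ge.
have [L LE] : exists L, L = ln (n%:R : R) by exists (ln n%:R).
rewrite -LE in nE hL0 hL2 hL3 hL4 hL5.
set u := expR (- (sigma ^+ 2 * L)).
have u0 : 0 < u by exact: expR_gt0.
have u2 : u <= 1 / 2.
  by rewrite /u expRN div1r lef_pV2 ?posrE ?expR_gt0.
have u01 : 0 < u < 1 by lra.
pose D := expR (- (beta * L)) * (expR (- (kappa * L)) / 2).
have D0 : 0 < D by rewrite mulr_gt0 ?divr_gt0 ?expR_gt0.
have epsE : eps beta n = expR (- (beta * L)).
  by rewrite /eps /powR pnatr_eq0 gtn_eqF// -LE mulNr.
have nD : n%:R * D = expR (a * L) / 2.
  by rewrite nE /D !mulrA -!expRD /a; congr (expR _ / 2); ring.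
have nD2 : n%:R * D ^+ 2 = u * expR (b * L) / 4.
  rewrite nE (_ : D ^+ 2 = expR (- (beta * L) * 2 + - (kappa * L) * 2) / 4).
    by rewrite mulrA -!expRD /b; congr (expR _ / 4); ring.
  by rewrite expRD !expRM_natr /D; field.
pose H := alt_cdf (eps beta n) (law_cdf (chi2 0)) (law_cdf (chi2 (dlt r n))) u.
have uDH : u + D <= H.
  have := hL1 _ hL0 (eps beta n); rewrite epsE /H /dlt -LE epsE.
  by apply; exact: expR_ge0.
have tq : t * q u <= Num.sqrt n%:R * (D / 2).
  have q2 : q u ^+ 2 <= u * (sigma ^+ 2 * L + 1).
    have := @q_le R u; rewrite u0 u2 => /(_ isT).
    by rewrite expRK opprK addrC.
  have E0 : 0 <= Num.sqrt n%:R * (D / 2).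
    by rewrite mulr_ge0// divr_ge0// ltW.
  (* Comparing squares suffices for either sign of [t], the right-hand side being nonnegative. *)
  have : (t * q u) ^+ 2 <= (Num.sqrt n%:R * (D / 2)) ^+ 2.
    have -> : (Num.sqrt n%:R * (D / 2)) ^+ 2 = n%:R * D ^+ 2 / 4.
      by rewrite exprMn sqr_sqrtr//; field.
    rewrite nD2 exprMn.
    apply: (@le_trans _ _ (t ^+ 2 * (u * (sigma ^+ 2 * L + 1)))).
      by rewrite ler_wpM2l// sqr_ge0.
    rewrite mulrCA -!mulrA ler_pM2l//; lra.
  move: (t * q u) (Num.sqrt _ * _) E0 => x y; nra.
have := Tplus_power indX n0 u01 (fun i => cdfX i u u01) D0 uDH tq.
apply: le_trans; rewrite lee_fin lerD2l lerN2 nD nD2.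
have -> : 4 * u / (u * expR (b * L) / 4) = 16 / expR (b * L).
  by field; rewrite !gt_eqF// expR_gt0.
have -> : 4 / (expR (a * L) / 2) = 8 / expR (a * L).
  by field; rewrite !gt_eqF// expR_gt0.
have hb : 16 / expR (b * L) <= e / 2.
  by rewrite ler_pdivrMr ?expR_gt0//; move: hL2; rewrite ler_pdivrMr//; lra.
have ha : 8 / expR (a * L) <= e / 2.
  by rewrite ler_pdivrMr ?expR_gt0//; move: hL3; rewrite ler_pdivrMr//; lra.
lra.
Unshelve. all: by end_near. Qed.
End power.
Theorem theorem4p2 (R : realType)
  (dB : measure_display) (TB : measurableType dB) (PB : probability TB R)
  (B : R -> {RV PB >-> R}) (hB : brownian_bridge B)
  (alpha : R) (halpha : 0 < alpha < 1)
  (t : R) (ht : PB [set w | (t%:E <= sup_bridge B w)%E] = alpha%:E)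
  (nu : nat) (hnu : (1 <= nu)%N)
  (chi2 : R -> probability (measurableTypeR R) R)
  (hchi2 : forall delta : R, 0 <= delta ->
     is_noncentral_chi2 nu delta (chi2 delta))
  (beta r : R) (hbeta : 1 / 2 < beta < 1) (hr : 0 < r < 1)
  (hrho : rho beta < r)
  (d : nat -> measure_display) (T : forall n : nat, measurableType (d n))
  (P : forall n : nat, probability (T n) R)
  (S : forall n : nat, 'I_n -> {RV (P n) >-> R})
  (hS01 : forall (n : nat) (i : 'I_n) (w : T n), 0 <= S n i w <= 1)
  (hSindep : forall n : nat, mutually_independent (S n))
  (hScdf : forall (n : nat) (i : 'I_n) (u : R), 0 < u < 1 ->
     cdf (S n i) u =
     (alt_cdf (eps beta n) (law_cdf (chi2 0)) (law_cdf (chi2 (dlt r n))) u)%:E) :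
  (fun n : nat => P n [set w | (t%:E <= Tplus (fun i => S n i w))%E])
    @ \oo --> 1%E.
Proof.
have P01 n : (0 <= P n [set w | (t%:E <= Tplus (fun i => S n i w))%E] <= 1)%E.
  by rewrite measure_ge0 probability_le1//; exact: measurable_Tplus_ge.
have Pfin n : P n [set w | (t%:E <= Tplus (fun i => S n i w))%E] \is a fin_num.
  by rewrite fin_num_measure//; exact: measurable_Tplus_ge.
apply/fine_cvgP; split; first by near=> n.
apply/cvgrPdist_le => e e0.
apply: filterS (detection_power t hnu hchi2 hbeta hr hrho e0) => n power_n.
have lb := power_n _ _ _ _ (hSindep n) (hScdf n).
have PE := fineK (Pfin n); rewrite -PE lee_fin in lb.
have ub := (andP (P01 n)).2; rewrite -PE lee_fin in ub.
by rewrite /= ger0_norm; lra.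
Unshelve. all: by end_near. Qed.
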